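(* Let $\mathcal{A}$ be an arbitrary Hopf algebra with invertible antipode over a field. The correspondence $P\mapsto\mathcal{N}_P$ induces a bijection between the set of two sided group-like projections in $\mathcal{A}$ and the set of semisimple left coideal subalgebras of $\mathcal{A}$ preserved by the squared antipode $S^2$.
   Context: $(\mathcal{A},\Delta,S,\varepsilon)$ is a Hopf algebra over an arbitrary field; by standing convention its antipode $S$ is invertible; $1$ is the unit. A left coideal subalgebra is a unital subalgebra $\mathcal{N}\subset\mathcal{A}$ with $\Delta(\mathcal{N})\subset\mathcal{A}\otimes\mathcal{N}$; it is preserved by $S^2$ if $S^2(\mathcal{N})=\mathcal{N}$. A projection is an idempotent. A non-zero projection $P\in\mathcal{A}$ is a right group-like projection if $\Delta(P)(1\otimes P)=P\otimes P=(1\otimes P)\Delta(P)$, a left group-like projection if $\Delta(P)(P\otimes 1)=P\otimes P=(P\otimes 1)\Delta(P)$, and a two sided group-like projection if it is both. $\mathcal{N}_P=\{x\in\mathcal{A}:\Delta(x)(1\otimes P)=(1\otimes P)\Delta(x)=x\otimes P\}$. *)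

(* Defs.v *)
From HB Require Import structures.
From mathcomp Require Import all_boot all_order all_algebra.
From mathcomp Require Import all_classical.

Set Implicit Arguments.
Unset Strict Implicit.
Unset Printing Implicit Defensive.

Import GRing.Theory.

Local Open Scope quotient_scope.
Local Open Scope classical_set_scope.
Local Open Scope ring_scope.

Reserved Notation "U ⊗ V" (at level 40, left associativity).

(* The tensor product over a field of two, possibly infinite-dimensional,
   spaces: formal finite sums of pairs modulo the usual relations.  The list
   [:: (u1, v1); ...; (un, vn)] stands for u1 ⊗ v1 + ... + un ⊗ vn; no
   coefficients are needed since a(u ⊗ v) = (a u) ⊗ v. *)
Section TensorProduct.
Variables (K : fieldType) (U V : lmodType K).
Implicit Types s t : seq (U * V).

Inductive tensor_eq : seq (U * V) -> seq (U * V) -> Prop :=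
| TensorRefl s : tensor_eq s s
| TensorSym s t : tensor_eq s t -> tensor_eq t s
| TensorTrans s t r : tensor_eq s t -> tensor_eq t r -> tensor_eq s r
| TensorCat s s' t t' :
    tensor_eq s s' -> tensor_eq t t' -> tensor_eq (s ++ t) (s' ++ t')
| TensorCatC s t : tensor_eq (s ++ t) (t ++ s)
| Tensor0l v : tensor_eq [:: (0, v)] [::]
| TensorDl u u' v : tensor_eq [:: (u + u', v)] [:: (u, v); (u', v)]
| TensorDr u v v' : tensor_eq [:: (u, v + v')] [:: (u, v); (u, v')]
| TensorZ a u v : tensor_eq [:: (a *: u, v)] [:: (u, a *: v)].

Definition tensor_eqb s t : bool := `[< tensor_eq s t >].

Lemma tensor_eqb_refl : reflexive tensor_eqb.
Proof. by move=> s; apply/asboolP/TensorRefl. Qed.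

Lemma tensor_eqb_sym : symmetric tensor_eqb.
Proof. by move=> s t; apply/asboolP/asboolP; apply: TensorSym. Qed.

Lemma tensor_eqb_trans : transitive tensor_eqb.
Proof.
by move=> t s r /asboolP st /asboolP tr; apply/asboolP; apply: TensorTrans tr.
Qed.

Canonical tensor_equiv :=
  EquivRel tensor_eqb tensor_eqb_refl tensor_eqb_sym tensor_eqb_trans.

Definition tensor := {eq_quot tensor_equiv}.
HB.instance Definition _ := Choice.on tensor.

Definition pi_tensor s : tensor := \pi_({eq_quot tensor_equiv}) s.

Lemma pi_tensorP s t : pi_tensor s = pi_tensor t <-> tensor_eq s t.
Proof.
split; last by move=> /asboolP st; apply/eqquotP.
by move=> /eqquotP /asboolP.
Qed.

Lemma repr_pi_tensor s : tensor_eq (repr (pi_tensor s)) s.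
Proof. by apply/pi_tensorP; rewrite /pi_tensor reprK. Qed.

Lemma pi_tensor_repr (x : tensor) : pi_tensor (repr x) = x.
Proof. by rewrite /pi_tensor reprK. Qed.

Definition tensor_add (x y : tensor) : tensor := pi_tensor (repr x ++ repr y).

Definition tensor_scale (a : K) (x : tensor) : tensor :=
  pi_tensor [seq (a *: p.1, p.2) | p <- repr x].

Lemma tensor_addE s t :
  tensor_add (pi_tensor s) (pi_tensor t) = pi_tensor (s ++ t).
Proof. by apply/pi_tensorP; apply: TensorCat; apply: repr_pi_tensor. Qed.

Lemma tensor_eq_scale a s t : tensor_eq s t ->
  tensor_eq [seq (a *: p.1, p.2) | p <- s] [seq (a *: p.1, p.2) | p <- t].
Proof.
elim => //=.
- by move=> *; apply: TensorRefl.
- by move=> *; apply: TensorSym.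
- by move=> *; apply: TensorTrans; eassumption.
- by move=> *; rewrite !map_cat; apply: TensorCat.
- by move=> *; rewrite !map_cat; apply: TensorCatC.
- by move=> v; rewrite scaler0; apply: Tensor0l.
- by move=> *; rewrite scalerDr; apply: TensorDl.
- by move=> *; apply: TensorDr.
- by move=> b u v; rewrite scalerA mulrC -scalerA; apply: TensorZ.
Qed.

Lemma tensor_scaleE a s :
  tensor_scale a (pi_tensor s) = pi_tensor [seq (a *: p.1, p.2) | p <- s].
Proof. exact/pi_tensorP/tensor_eq_scale/repr_pi_tensor. Qed.

Lemma tensor_addA : associative tensor_add.
Proof.
move=> x y z; rewrite -[x]pi_tensor_repr -[y]pi_tensor_repr.
by rewrite -[z]pi_tensor_repr !tensor_addE catA.
Qed.

Lemma tensor_addC : commutative tensor_add.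
Proof. by move=> x y; apply/pi_tensorP/TensorCatC. Qed.

Lemma tensor_add0 : left_id (pi_tensor [::]) tensor_add.
Proof. by move=> x; rewrite -[x]pi_tensor_repr tensor_addE. Qed.

Lemma tensor_eq_scale0 s : tensor_eq [seq (0 *: p.1, p.2) | p <- s] [::].
Proof.
elim: s => [|p s IHs] /=; first exact: TensorRefl.
by rewrite scale0r; apply: (TensorCat (Tensor0l p.2) IHs).
Qed.

Lemma tensor_eq_scaleD a b s : tensor_eq [seq ((a + b) *: p.1, p.2) | p <- s]
  ([seq (a *: p.1, p.2) | p <- s] ++ [seq (b *: p.1, p.2) | p <- s]).
Proof.
elim: s => [|p s IHs] /=; first exact: TensorRefl.
rewrite scalerDl.
apply: TensorTrans (TensorCat (TensorDl _ _ _) IHs) _.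
apply: (@TensorCat [:: _] [:: _]); first exact: TensorRefl.
rewrite -cat_rcons -cats1.
exact: (TensorCat (TensorCatC [:: _] _) (TensorRefl _)).
Qed.

Definition tensor_opp (x : tensor) : tensor := tensor_scale (-1) x.

Lemma tensor_scale1 : left_id 1 tensor_scale.
Proof.
move=> x; rewrite -[x]pi_tensor_repr tensor_scaleE.
by congr pi_tensor; apply: map_id_in => -[u v] _; rewrite scale1r.
Qed.

Lemma tensor_addN : left_inverse (pi_tensor [::]) tensor_opp tensor_add.
Proof.
move=> x; rewrite -[X in tensor_add _ X]tensor_scale1 -[x]pi_tensor_repr.
rewrite /tensor_opp !tensor_scaleE tensor_addE; apply/pi_tensorP.
apply: TensorTrans (TensorSym (tensor_eq_scaleD _ _ _)) _.
by rewrite addNr; apply: tensor_eq_scale0.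
Qed.

HB.instance Definition _ := GRing.isZmodule.Build tensor
  tensor_addA tensor_addC tensor_add0 tensor_addN.

Lemma tensor_scaleA a b x :
  tensor_scale a (tensor_scale b x) = tensor_scale (a * b) x.
Proof.
rewrite -[x]pi_tensor_repr !tensor_scaleE -map_comp; congr pi_tensor.
by apply: eq_map => p /=; rewrite scalerA.
Qed.

Lemma tensor_scaleDr : right_distributive tensor_scale +%R.
Proof.
move=> a x y; rewrite -[x]pi_tensor_repr -[y]pi_tensor_repr.
by rewrite [X in tensor_scale _ X]tensor_addE !tensor_scaleE map_cat -tensor_addE.
Qed.

Lemma tensor_scaleDl x : {morph tensor_scale^~ x : a b / a + b}.
Proof.
move=> a b; rewrite -[x]pi_tensor_repr !tensor_scaleE.
rewrite [RHS]tensor_addE; exact/pi_tensorP/tensor_eq_scaleD.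
Qed.

HB.instance Definition _ := GRing.Zmodule_isLmodule.Build K tensor
  tensor_scaleA tensor_scale1 tensor_scaleDr tensor_scaleDl.

Definition tens (u : U) (v : V) : tensor := pi_tensor [:: (u, v)].

Lemma tens_bilinear : bilinear_for *:%R *:%R tens.
Proof.
split=> [v a u u'|u a v v'] /=;
  rewrite [X in _ = X + _]tensor_scaleE [RHS]tensor_addE.
  exact/pi_tensorP/TensorDl.
apply/pi_tensorP; apply: TensorTrans (TensorDr _ _ _) _; rewrite /= -cat1s.
apply: (@TensorCat [:: _] [:: _]); last exact: TensorRefl.
exact/TensorSym/TensorZ.
Qed.

HB.instance Definition _ :=
  bilinear_isBilinear.Build K U V tensor *:%R *:%R tens tens_bilinear.

Lemma tensorE (x : tensor) : x = \sum_(p <- repr x) tens p.1 p.2.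
Proof.
rewrite -{1}[x]pi_tensor_repr; elim: (repr x) => [|[u v] s IHs].
  by rewrite big_nil.
by rewrite big_cons -IHs [RHS]tensor_addE.
Qed.

Lemma tensor_ind (P : tensor -> Prop) :
    P 0 -> (forall x y, P x -> P y -> P (x + y)) ->
    (forall u v, P (tens u v)) ->
  forall x, P x.
Proof.
by move=> P0 PD Pt x; rewrite [x]tensorE; apply: (big_ind P) => // p _.
Qed.

(* The linear map induced by f : U -> V -> W; meaningful for f bilinear, in
   which case it does not depend on the chosen representative. *)
Definition tensor_lift (W : lmodType K) (f : U -> V -> W) (x : tensor) : W :=
  \sum_(p <- repr x) f p.1 p.2.

Section Lift.
Variables (W : lmodType K) (f : U -> V -> W).
Hypothesis bilf : bilinear_for *:%R *:%R f.

Lemma bilinear0l v : f 0 v = 0.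
Proof. by have := bilf.1 v (-1) 0 0; rewrite /= !scaleN1r !addNr. Qed.

Lemma bilinear0r u : f u 0 = 0.
Proof. by have := bilf.2 u (-1) 0 0; rewrite /= !scaleN1r !addNr. Qed.

Lemma tensor_eq_lift s t : tensor_eq s t ->
  \sum_(p <- s) f p.1 p.2 = \sum_(p <- t) f p.1 p.2.
Proof.
have [fl fr] := bilf.
elim=> {s t} //=.
- by move=> s t r _ -> _ ->.
- by move=> s s' t t' _ IHs _ IHt; rewrite !big_cat /= IHs IHt.
- by move=> s t; rewrite !big_cat /= addrC.
- by move=> v; rewrite big_seq1 big_nil /= bilinear0l.
- move=> u u' v; rewrite big_seq1 big_cons big_seq1 /=.
  by have := fl v 1 u u'; rewrite /= !scale1r.
- move=> u v v'; rewrite big_seq1 big_cons big_seq1 /=.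
  by have := fr u 1 v v'; rewrite /= !scale1r.
- move=> a u v; rewrite !big_seq1 /=.
  have := fl v a u 0; rewrite /= bilinear0l !addr0 => ->.
  by have := fr u a v 0; rewrite /= bilinear0r !addr0 => ->.
Qed.

Lemma tensor_lift_pi s : tensor_lift f (pi_tensor s) = \sum_(p <- s) f p.1 p.2.
Proof. exact/tensor_eq_lift/repr_pi_tensor. Qed.

Lemma tensor_lift_tens u v : tensor_lift f (tens u v) = f u v.
Proof. by rewrite tensor_lift_pi big_seq1. Qed.

Lemma tensor_lift_linear : linear (tensor_lift f).
Proof.
move=> a x y; have [fl _] := bilf.
rewrite -[x]pi_tensor_repr -[y]pi_tensor_repr.
rewrite [X in X + pi_tensor _]tensor_scaleE [X in tensor_lift _ X]tensor_addE.
rewrite !tensor_lift_pi big_cat /= big_map; congr (_ + _).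
rewrite scaler_sumr; apply: eq_bigr => p _ /=.
by have := fl p.2 a p.1 0; rewrite /= bilinear0l !addr0.
Qed.

End Lift.

Lemma tensor_ext (W : lmodType K) (g h : {linear tensor -> W}) :
  (forall u v, g (tens u v) = h (tens u v)) -> g =1 h.
Proof.
move=> gh x; rewrite [x]tensorE !raddf_sum.
by apply: eq_bigr => p _; apply: gh.
Qed.

End TensorProduct.

Arguments tensor_lift {K U V W}.

Notation "U ⊗ V" := (tensor U V) : type_scope.
Notation "u ⊗ v" := (tens u v) : ring_scope.

Section TensorAlgebra.
Variables (K : fieldType) (A B : algType K).
Implicit Types x y z : (A ⊗ B)%type.

Definition tensor_mul x y : (A ⊗ B)%type :=
  tensor_lift (fun a b => tensor_lift (fun c d => (a * c) ⊗ (b * d)) y) x.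

Lemma tensor_mul_bilinear_in a b :
  bilinear_for *:%R *:%R (fun (c : A) (d : B) => (a * c) ⊗ (b * d)).
Proof.
split=> [d k c c'|c k d d'] /=; rewrite mulrDr -scalerAr.
  by rewrite linearPl.
by rewrite linearPr.
Qed.

Lemma tensor_mul_bilinear_out y : bilinear_for *:%R *:%R
  (fun a b => tensor_lift (fun c d => (a * c) ⊗ (b * d)) y).
Proof.
split=> [b k a a'|a k b b'] /=; rewrite /tensor_lift scaler_sumr -big_split.
  by apply: eq_bigr => p _ /=; rewrite mulrDl -scalerAl linearPl.
by apply: eq_bigr => p _ /=; rewrite mulrDl -scalerAl linearPr.
Qed.

Lemma tensor_mulE a b c d : tensor_mul (a ⊗ b) (c ⊗ d) = (a * c) ⊗ (b * d).
Proof.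
rewrite /tensor_mul (tensor_lift_tens (tensor_mul_bilinear_out _)).
exact: (tensor_lift_tens (tensor_mul_bilinear_in _ _)).
Qed.

Lemma tensor_mul_linearl y : linear (tensor_mul^~ y).
Proof. exact: tensor_lift_linear (tensor_mul_bilinear_out y). Qed.

Lemma tensor_mul_linearr x : linear (tensor_mul x).
Proof.
move=> k y y'; rewrite /tensor_mul /(tensor_lift _ x) scaler_sumr -big_split.
apply: eq_bigr => p _ /=.
exact: (tensor_lift_linear (tensor_mul_bilinear_in _ _)).
Qed.

Lemma tensor_mul_bilinear : bilinear_for *:%R *:%R tensor_mul.
Proof.
split; [exact: tensor_mul_linearl | exact: tensor_mul_linearr].
Qed.

HB.instance Definition _ := bilinear_isBilinear.Build K _ _ _ *:%R *:%R
  tensor_mul tensor_mul_bilinear.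

Lemma tensor_mulA : associative tensor_mul.
Proof.
move=> x y z; elim/tensor_ind: x => [|x x' IHx IHx'|a a'].
- by rewrite !linear0l.
- by rewrite !linearDl /= IHx IHx'.
elim/tensor_ind: y => [|y y' IHy IHy'|b b'].
- by rewrite !(linear0l, linear0r).
- by rewrite !(linearDl, linearDr) /= IHy IHy'.
elim/tensor_ind: z => [|z z' IHz IHz'|c c'].
- by rewrite !linear0r.
- by rewrite !linearDr /= IHz IHz'.
by rewrite !tensor_mulE !mulrA.
Qed.

Lemma tensor_mul1l : left_id ((1 : A) ⊗ (1 : B)) tensor_mul.
Proof.
elim/tensor_ind => [|x y IHx IHy|a b]; first exact: linear0r.
  by rewrite linearDr /= IHx IHy.
by rewrite tensor_mulE !mul1r.
Qed.

Lemma tensor_mul1r : right_id ((1 : A) ⊗ (1 : B)) tensor_mul.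
Proof.
elim/tensor_ind => [|x y IHx IHy|a b]; first exact: linear0l.
  by rewrite linearDl /= IHx IHy.
by rewrite tensor_mulE !mulr1.
Qed.

Lemma tensor_mulDl : left_distributive tensor_mul +%R.
Proof. by move=> x y z; rewrite linearDl. Qed.

Lemma tensor_mulDr : right_distributive tensor_mul +%R.
Proof. by move=> x y z; rewrite linearDr. Qed.

HB.instance Definition _ := GRing.Zmodule_isPzRing.Build (A ⊗ B)%type
  tensor_mulA tensor_mul1l tensor_mul1r tensor_mulDl tensor_mulDr.

Lemma tens1 : (1 : A) ⊗ (1 : B) = 1.
Proof. by []. Qed.

Lemma tensM (a c : A) (b d : B) : (a ⊗ b) * (c ⊗ d) = (a * c) ⊗ (b * d).
Proof. exact: tensor_mulE. Qed.

Lemma tensor_scaleAl k x y : k *: (x * y) = (k *: x) * y.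
Proof. by rewrite -[RHS]/(tensor_mul (k *: x) y) linearZl_LR. Qed.

Lemma tensor_scaleAr k x y : k *: (x * y) = x * (k *: y).
Proof. by rewrite -[RHS]/(tensor_mul x (k *: y)) linearZr_LR. Qed.

End TensorAlgebra.

Definition tensor_map (K : fieldType) (U V U' V' : lmodType K)
    (f : U -> U') (g : V -> V') : (U ⊗ V)%type -> (U' ⊗ V')%type :=
  tensor_lift (fun u v => f u ⊗ g v).

Definition tensor_assoc (K : fieldType) (U V W : lmodType K) :
    ((U ⊗ V) ⊗ W)%type -> (U ⊗ (V ⊗ W))%type :=
  tensor_lift (fun x w => tensor_lift (fun u v => u ⊗ (v ⊗ w)) x).

Section TensorMaps.
Variable K : fieldType.

Lemma tensor_map_tens (U V U' V' : lmodType K)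
    (f : {linear U -> U'}) (g : {linear V -> V'}) u v :
  tensor_map f g (u ⊗ v) = f u ⊗ g v.
Proof.
apply: tensor_lift_tens; split=> [{}v a {}u u'|{}u a {}v v'] /=.
  by rewrite linearP linearPl.
by rewrite linearP linearPr.
Qed.

Lemma tensor_assoc_tens (U V W : lmodType K) (u : U) (v : V) (w : W) :
  tensor_assoc ((u ⊗ v) ⊗ w) = u ⊗ (v ⊗ w).
Proof.
have bil w' : bilinear_for *:%R *:%R (fun (u : U) (v : V) => u ⊗ (v ⊗ (w' : W))).
  split=> [v' a u1 u2|u' a v1 v2] /=; first by rewrite linearPl.
  by rewrite linearPl linearPr.
rewrite /tensor_assoc tensor_lift_tens; first exact: tensor_lift_tens.
split=> [w' a x y|x a w1 w2] /=; first exact: tensor_lift_linear.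
rewrite /tensor_lift scaler_sumr -big_split; apply: eq_bigr => p _ /=.
by rewrite !linearPr.
Qed.

End TensorMaps.

HB.mixin Record Algebra_isHopf (K : fieldType) A of GRing.Algebra K A := {
  comul : A -> (A ⊗ A)%type;
  counit : A -> K;
  antipode : A -> A;
  comul_linear : linear comul;
  comul_monoid : monoid_morphism comul;
  counit_linear : scalar counit;
  counit_monoid : monoid_morphism counit;
  antipode_linear : linear antipode;
  comulA : forall x : A,
    tensor_assoc (tensor_map comul id (comul x)) = tensor_map id comul (comul x);
  comul_counitl : forall x : A,
    tensor_lift (fun a b => counit a *: b) (comul x) = x;
  comul_counitr : forall x : A,
    tensor_lift (fun a b => counit b *: a) (comul x) = x;
  comul_antipodel : forall x : A,
    tensor_lift (fun a b => antipode a * b) (comul x) = (counit x)%:A;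
  comul_antipoder : forall x : A,
    tensor_lift (fun a b => a * antipode b) (comul x) = (counit x)%:A
}.

#[short(type="hopfAlgType")]
HB.structure Definition Hopf (K : fieldType) :=
  {A of GRing.Algebra K A & Algebra_isHopf K A}.

HB.instance Definition _ (K : fieldType) (A : hopfAlgType K) :=
  GRing.isLinear.Build K A (A ⊗ A)%type *:%R comul comul_linear.
HB.instance Definition _ (K : fieldType) (A : hopfAlgType K) :=
  GRing.isMonoidMorphism.Build A (A ⊗ A)%type comul comul_monoid.
HB.instance Definition _ (K : fieldType) (A : hopfAlgType K) :=
  GRing.isLinear.Build K A K *%R counit counit_linear.
HB.instance Definition _ (K : fieldType) (A : hopfAlgType K) :=
  GRing.isMonoidMorphism.Build A K counit counit_monoid.
HB.instance Definition _ (K : fieldType) (A : hopfAlgType K) :=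
  GRing.isLinear.Build K A A *:%R antipode antipode_linear.

Notation Δ := comul.

Section GroupLikeProjections.
Variables (K : fieldType) (A : hopfAlgType K).
Implicit Types (P x : A) (N I J : set A).

Definition nonzero_projection P := P != 0 /\ P * P = P.

Definition right_group_like_projection P :=
  [/\ nonzero_projection P,
      Δ P * (1 ⊗ P) = P ⊗ P
    & (1 ⊗ P) * Δ P = P ⊗ P].

Definition left_group_like_projection P :=
  [/\ nonzero_projection P,
      Δ P * (P ⊗ 1) = P ⊗ P
    & (P ⊗ 1) * Δ P = P ⊗ P].

Definition two_sided_group_like_projection P :=
  right_group_like_projection P /\ left_group_like_projection P.

Definition stabilizer P : set A :=
  [set x | Δ x * (1 ⊗ P) = x ⊗ P /\ (1 ⊗ P) * Δ x = x ⊗ P].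

(* The subspace A ⊗ N of A ⊗ A. *)
Definition tensor_setr N : set (A ⊗ A)%type :=
  [set t | exists2 s : seq (A * A), (forall p, p \in s -> N p.2)
                                  & t = \sum_(p <- s) p.1 ⊗ p.2].

Definition left_coideal_subalgebra N :=
  GRing.subalg_closed (mem N) /\ Δ @` N `<=` tensor_setr N.

Definition left_ideal N I :=
  [/\ I `<=` N, GRing.submod_closed (mem I)
    & forall x y, N x -> I y -> I (x * y)].

(* N is semisimple as a left module over itself: every left ideal of N is a
   direct summand of N. *)
Definition semisimple N :=
  forall I, left_ideal N I ->
  exists J, [/\ left_ideal N J, I `&` J = [set 0]
              & N = [set x + y | x in I & y in J]].

Definition preserved_by_antipode_sqr N :=
  (antipode \o antipode : A -> A) @` N = N.

End GroupLikeProjections.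

(* Main.v *)
Require Import Defs.
From mathcomp Require Import all_boot all_order all_algebra.
From mathcomp Require Import all_classical.

(** Write S for the antipode, ε for the counit, N_P for the stabilizer of P and
    M_P for its mirror image, defined by Δ(x)(P ⊗ 1) = P ⊗ x = (P ⊗ 1)Δ(x).
    A projection P is right group-like when P ∈ N_P and left group-like when
    P ∈ M_P.  Applying ε ⊗ id to the definition of N_P gives
    x P = ε(x) P = P x for x ∈ N_P, so that P is a two-sided integral of N_P
    with ε(P) = 1.  Such an integral is unique, hence P ↦ N_P is injective.

    Everything else rests on one identity ([stabilizer_twist]):
      (1 ⊗ x) Δ(P) = (S(x) ⊗ 1) Δ(P)   for x ∈ N_P.
    For x = P it compares the two group-like conditions: if P is two sided
    then (S(P) ⊗ 1) Δ(P) = (P ⊗ 1) Δ(P), and contracting with a ⊗ b ↦ a S(b)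
    yields S(P) = P ([two_sided_antipode]).  Then S and its inverse exchange
    N_P and M_P, so N_P is preserved by S^2.

    If P is two sided, coassociativity puts Δ(P) in M_P ⊗ N_P
    ([comul_decomposition]).  Writing Δ(P) = ∑ a_i ⊗ b_i accordingly,
    the element ∑ b_i ⊗ S^-1(a_i) lies in N_P ⊗ N_P; by the twist identity it
    commutes with N_P and it multiplies to ε(P) = 1.  It is a separability
    idempotent, so averaging a linear projection onto a left ideal makes it
    N_P-linear: N_P is semisimple ([semisimple_stabilizer]).

    Conversely let N be a semisimple left coideal subalgebra with S^2(N) = N.
    A complement of N ∩ ker ε is spanned by an integral P with ε(P) = 1, and
    semisimplicity forces P to be two sided as an integral
    ([semisimple_integral]).  Since Δ(N) lies in A ⊗ N, N is contained in N_P;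
    in particular P is right group-like.  Uniqueness of integrals gives
    S^2(P) = P, and the twist identity then gives S(P) = P, so P is left
    group-like too.  Finally N_P is contained in N ([stabilizer_sub]): by the
    twist identity y b ∈ N whenever y ∈ N_P and b is a slice of Δ(P), while
    x = ∑ x S(a_i) b_i with x S(a_i) ∈ N_P.

    The algebra may be infinite dimensional; the few facts needed about
    subspaces of tensor products are obtained by slicing a tensor with
    functionals, whose existence comes from Zorn's lemma. *)

Set Implicit Arguments.
Unset Strict Implicit.
Unset Printing Implicit Defensive.

Import GRing.Theory.

Local Open Scope classical_set_scope.
Local Open Scope ring_scope.

(** * Sums over tensors *)

(* Sweedler notation: the sum over the terms a ⊗ b of t. *)
Local Notation "'∑(' a ',' b '←' t ')' E" := (tensor_lift (fun a b => E) t)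
  (at level 41, a name, b name, t at level 41, E at level 41,
   format "'∑(' a ','  b  '←'  t ')'  E").
Local Notation bilin f := (bilinear_for *:%R *:%R f).

Section Linearity.
Context {K : fieldType} {U V W X : lmodType K} {A B : algType K}.

Lemma lin_id : linear (fun x : U => x). Proof. by []. Qed.

Lemma lin_comp (g : V -> W) (f : U -> V) :
  linear g -> linear f -> linear (fun x => g (f x)).
Proof. by move=> lg lf k x y /=; rewrite lf lg. Qed.

Lemma scal_comp (g : V -> K) (f : U -> V) :
  scalar g -> linear f -> scalar (fun x => g (f x)).
Proof. by move=> lg lf k x y /=; rewrite lf lg. Qed.

Lemma lin_scalel (f : U -> K) (v : V) : scalar f -> linear (fun x => f x *: v).
Proof. by move=> lf k x y; rewrite lf scalerDl scalerA. Qed.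

Lemma lin_scaler (f : U -> V) c : linear f -> linear (fun x => c *: f x).
Proof. by move=> lf k x y; rewrite lf scalerDr !scalerA mulrC. Qed.

Lemma lin_mull (f : U -> A) c : linear f -> linear (fun x => f x * c).
Proof. by move=> lf k x y; rewrite lf mulrDl scalerAl. Qed.

Lemma lin_mulr (f : U -> A) c : linear f -> linear (fun x => c * f x).
Proof. by move=> lf k x y; rewrite lf mulrDr scalerAr. Qed.

Lemma lin_tmull (f : U -> (A ⊗ B)%type) c :
  linear f -> linear (fun x => f x * c).
Proof. by move=> lf k x y; rewrite lf mulrDl tensor_scaleAl. Qed.

Lemma lin_tmulr (f : U -> (A ⊗ B)%type) c :
  linear f -> linear (fun x => c * f x).
Proof. by move=> lf k x y; rewrite lf mulrDr tensor_scaleAr. Qed.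

Lemma lin_tensl (f : U -> V) (w : W) : linear f -> linear (fun x => f x ⊗ w).
Proof. by move=> lf k x y; rewrite lf linearPl. Qed.

Lemma lin_tensr (f : U -> V) (w : W) : linear f -> linear (fun x => w ⊗ f x).
Proof. by move=> lf k x y; rewrite lf linearPr. Qed.

Lemma lin_lift (f : U -> V -> W -> X) t :
  (forall a b, linear (fun x => f x a b)) ->
  linear (fun x => tensor_lift (f x) t).
Proof.
move=> lf k x y; rewrite /tensor_lift scaler_sumr -big_split.
by apply: eq_bigr => p _; apply: lf.
Qed.

Lemma lin_lift_arg (f : V -> W -> X) (g : U -> (V ⊗ W)%type) :
  bilin f -> linear g -> linear (fun x => tensor_lift f (g x)).
Proof. by move=> lf lg k x y; rewrite lg (tensor_lift_linear lf). Qed.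

End Linearity.

(** [lin] proves linearity and bilinearity of an expression by following its
    syntax; the lifts of bilinear maps to tensors only make sense under these
    side conditions.  The cases of partially applied operations are there
    because unification eta-contracts the functions that it finds. *)
Ltac lin_base := cbv beta;
  first [assumption | exact: linearP
       | match goal with H : _ |- _ => exact: H end].

Ltac lin := cbv beta;
  lazymatch goal with
  | |- bilinear_for _ _ _ => split=> ?; lin
  | |- GRing.linear_for _ (fun x => x) => exact: lin_id
  | |- GRing.linear_for ?s (GRing.mul ?c) =>
      first [apply: (@lin_mulr _ _ _ (fun x => x) c); exact: lin_id
           | apply: (@lin_tmulr _ _ _ _ (fun x => x) c); exact: lin_id]
  | |- GRing.linear_for ?s (tens ?c) =>
      apply: (@lin_tensr _ _ _ _ (fun x => x) c); exact: lin_id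
  | |- GRing.linear_for ?s (GRing.scale ?c) =>
      apply: (@lin_scaler _ _ _ (fun x => x) c); exact: lin_id
  | |- GRing.linear_for _ (fun x => _ * _) =>
      first [apply: lin_mull; lin | apply: lin_mulr; lin
           | apply: lin_tmull; lin | apply: lin_tmulr; lin]
  | |- GRing.linear_for _ (fun x => _ ⊗ _) =>
      first [apply: lin_tensl; lin | apply: lin_tensr; lin]
  | |- GRing.linear_for _ (fun x => _ *: _) =>
      first [apply: lin_scalel; lin | apply: lin_scaler; lin]
  | |- GRing.linear_for _ (fun x => tensor_lift _ _) =>
      first [apply: lin_lift; move=> ? ?; lin | apply: lin_lift_arg; lin]
  | |- _ => first [lin_base | match goal with
      | |- GRing.linear_for _ (fun x => ?g (@?f x)) =>
          apply: (@lin_comp _ _ _ _ g f); [lin_base | lin]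
      | |- GRing.linear_for _ (fun x => ?g (@?f x)) =>
          apply: (@scal_comp _ _ _ g f); [lin_base | lin]
      | |- GRing.linear_for _ (fun x => ?g (@?f x) ?c) =>
          apply: (@lin_comp _ _ _ _ (fun y => g y c) f); lin
      | |- GRing.linear_for _ (fun x => ?g ?c (@?f x)) =>
          apply: (@lin_comp _ _ _ _ (g c) f); lin
      end]
  end.

Section LinearMaps.
Context {K : fieldType} {U V : lmodType K}.

Lemma lin0 {f : U -> V} : linear f -> f 0 = 0.
Proof. by move=> lf; have := lf (-1) 0 0; rewrite /= !scaleN1r !addNr. Qed.

Lemma linD {f : U -> V} : linear f -> {morph f : x y / x + y}.
Proof. by move=> lf x y; have := lf 1 x y; rewrite /= !scale1r. Qed.

Lemma linZ {f : U -> V} : linear f -> forall k, {morph f : x / k *: x}.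
Proof. by move=> lf k x; have := lf k x 0; rewrite /= (lin0 lf) !addr0. Qed.

Lemma linB {f : U -> V} : linear f -> {morph f : x y / x - y}.
Proof.
by move=> lf x y; rewrite (linD lf) -scaleN1r (linZ lf) scaleN1r.
Qed.

Lemma lin_sum {f : U -> V} : linear f -> forall I (r : seq I) (F : I -> U),
  f (\sum_(i <- r) F i) = \sum_(i <- r) f (F i).
Proof.
by move=> lf I r F; apply: (big_morph f); [apply: linD | apply: lin0].
Qed.

End LinearMaps.

Lemma eq_lift (K : fieldType) (U V W : lmodType K) (f g : U -> V -> W) t :
  (forall a b, f a b = g a b) -> tensor_lift f t = tensor_lift g t.
Proof. by move=> fg; apply: eq_bigr => p _; apply: fg. Qed.

Lemma lift_comp (K : fieldType) (U V W X : lmodType K) (g : W -> X)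
    (f : U -> V -> W) t : linear g ->
  g (tensor_lift f t) = ∑(a, b ← t) g (f a b).
Proof. by move=> lg; rewrite /tensor_lift (lin_sum lg). Qed.

Lemma lift_id (K : fieldType) (U V : lmodType K) (t : (U ⊗ V)%type) :
  (∑(a, b ← t) a ⊗ b) = t.
Proof. by rewrite [RHS]tensorE. Qed.

Lemma lift_lift (K : fieldType) (U V W X Y : lmodType K) (f : W -> X -> Y)
    (g : U -> V -> (W ⊗ X)%type) t : bilin f ->
  tensor_lift f (tensor_lift g t) = ∑(a, b ← t) tensor_lift f (g a b).
Proof. by move=> bf; apply: lift_comp; apply: tensor_lift_linear. Qed.

Lemma lift_swap (K : fieldType) (U V W X Y : lmodType K)
    (f : U -> V -> W -> X -> Y) s t :
  (∑(a, b ← s) ∑(c, d ← t) f a b c d) = ∑(c, d ← t) ∑(a, b ← s) f a b c d.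
Proof. exact: exchange_big. Qed.

Lemma liftE (K : fieldType) (U V W : lmodType K) (f : U -> V -> W) u v :
  bilin f -> tensor_lift f (u ⊗ v) = f u v.
Proof. by move=> bf; apply: (tensor_lift_tens bf). Qed.

Lemma lift_assoc (K : fieldType) (U V W X : lmodType K)
    (f : U -> V -> W -> X) t :
  (forall a b, linear (f a b)) -> (forall a c, linear (fun b => f a b c)) ->
  (forall b c, linear (fun a => f a b c)) ->
  (∑(a, y ← tensor_assoc t) ∑(b, c ← y) f a b c)
  = ∑(x, c ← t) ∑(a, b ← x) f a b c.
Proof.
move=> f3 f2 f1; rewrite lift_lift; last by lin.
apply: eq_lift => x c; rewrite lift_lift; last by lin.
by apply: eq_lift => a b; rewrite liftE ?liftE //; lin.
Qed.

Section Mul.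
Context {K : fieldType} {A B : algType K} {W : lmodType K}.

Lemma lift_mul (f : A -> B -> W) s t : bilin f ->
  tensor_lift f (s * t) = ∑(a, b ← s) ∑(c, d ← t) f (a * c) (b * d).
Proof.
move=> bf; rewrite [LHS](lift_lift _ _ bf).
apply: eq_lift => a b; rewrite lift_lift //.
by apply: eq_lift => c d; rewrite liftE.
Qed.

Lemma lift_mulr (f : A -> B -> W) s c d : bilin f ->
  tensor_lift f (s * (c ⊗ d)) = ∑(a, b ← s) f (a * c) (b * d).
Proof.
move=> [f1 f2]; rewrite lift_mul //; apply: eq_lift => a b; rewrite liftE //.
by lin.
Qed.

Lemma lift_mull (f : A -> B -> W) s c d : bilin f ->
  tensor_lift f ((c ⊗ d) * s) = ∑(a, b ← s) f (c * a) (d * b).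
Proof.
by move=> [f1 f2]; rewrite lift_mul // liftE //; lin.
Qed.

End Mul.

(** * Sweedler calculus *)

Section Hopf.
Context {K : fieldType} {A : hopfAlgType K}.
Implicit Types (x y z P : A).
Local Notation S := (@antipode K A).
Local Notation ε := (@counit K A).

Lemma coassoc {W : lmodType K} (f : A -> A -> A -> W) x :
  (forall a b, linear (f a b)) -> (forall a c, linear (fun b => f a b c)) ->
  (forall b c, linear (fun a => f a b c)) ->
  (∑(a, c ← Δ x) ∑(a, b ← Δ a) f a b c) = ∑(a, b ← Δ x) ∑(b, c ← Δ b) f a b c.
Proof.
move=> f3 f2 f1; have := comulA x.
move/(congr1 (tensor_lift (fun a t => tensor_lift (f a) t))).
rewrite lift_assoc // /tensor_map !lift_lift; try by lin.
under eq_lift => a b do (rewrite liftE; last by lin).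
by under [in X in _ = X -> _]eq_lift => a b do (rewrite liftE; last by lin).
Qed.

Lemma counitl {W : lmodType K} (f : A -> W) x : linear f ->
  (∑(a, b ← Δ x) ε a *: f b) = f x.
Proof.
move=> lf; rewrite -[in RHS](comul_counitl x) (lift_comp _ _ lf).
by apply: eq_lift => a b; rewrite (linZ lf).
Qed.

Lemma counitr {W : lmodType K} (f : A -> W) x : linear f ->
  (∑(a, b ← Δ x) ε b *: f a) = f x.
Proof.
move=> lf; rewrite -[in RHS](comul_counitr x) (lift_comp _ _ lf).
by apply: eq_lift => a b; rewrite (linZ lf).
Qed.

Lemma antipodel {W : lmodType K} (f : A -> W) x : linear f ->
  (∑(a, b ← Δ x) f (S a * b)) = ε x *: f 1.
Proof.
by move=> lf; rewrite -(lift_comp _ _ lf) comul_antipodel (linZ lf).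
Qed.

Lemma antipoder {W : lmodType K} (f : A -> W) x : linear f ->
  (∑(a, b ← Δ x) f (a * S b)) = ε x *: f 1.
Proof.
by move=> lf; rewrite -(lift_comp _ _ lf) comul_antipoder (linZ lf).
Qed.

Lemma comulM {W : lmodType K} (f : A -> A -> W) x y : bilin f ->
  tensor_lift f (Δ (x * y)) = ∑(a, b ← Δ x) ∑(c, d ← Δ y) f (a * c) (b * d).
Proof. by move=> bf; rewrite rmorphM lift_mul. Qed.

End Hopf.

(** * Properties of the antipode *)

Section Antipode.
Context {K : fieldType} {A : hopfAlgType K}.
Implicit Types (x y z P : A).
Local Notation S := (@antipode K A).
Local Notation ε := (@counit K A).

(** Insert ε(x_1 y_1) = S(x_1 y_1) x_2 y_2 in front of S(y) S(x); then
    S(x_1 y_1) x_2 y_2 S(y_3) S(x_3) collapses from the inside. *)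
Lemma antipodeM x y : S (x * y) = S y * S x.
Proof.
symmetry; transitivity (∑(a, b ← Δ x) ∑(p, q ← Δ a)
    ∑(c, d ← Δ y) ∑(r, s ← Δ c) (S (p * r) * (q * s) * (S d * S b))).
  rewrite -[S y * S x](counitl (f := fun z => S y * S z)); last by lin.
  apply: eq_lift => a b; rewrite lift_swap.
  rewrite -[S y](counitl (f := S)); last by lin.
  rewrite (lift_comp (g := fun z => ε a *: (z * S b))); last by lin.
  apply: eq_lift => c d.
  rewrite -scalerAl scalerA -rmorphM /=.
  rewrite -[in LHS](mul1r (S d * S b)).
  rewrite -(antipodel (f := fun z => z * (S d * S b))); last by lin.
  by rewrite comulM //; lin.
rewrite (coassoc (f := fun p q b => ∑(c, d ← Δ y) ∑(r, s ← Δ c)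
   (S (p * r) * (q * s) * (S d * S b)))); try by move=> *; lin.
rewrite -[RHS](counitr (f := fun z => S (z * y))); last by lin.
apply: eq_lift => p b.
rewrite -[S (p * y)]mulr1 -(antipoder (f := fun z => S (p * y) * z)); last by lin.
apply: eq_lift => q {}b.
rewrite (coassoc (f := fun r s d => S (p * r) * (q * s) * (S d * S b)));
  try by move=> *; lin.
rewrite -[in RHS](counitr (f := fun z => S (p * z) * (q * S b))); last by lin.
apply: eq_lift => r d.
have -> : S (p * r) * (q * S b) = S (p * r) * q * 1 * S b by rewrite mulr1 mulrA.
rewrite -(antipoder (f := fun z => S (p * r) * q * z * S b)); last by lin.
by apply: eq_lift => s e; rewrite !mulrA.
Qed.

(** A left and a right convolution inverse of g coincide, as f * g * h can be
    bracketed in two ways. *)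
Lemma convolution_inverse_unique (f g h : A -> (A ⊗ A)%type) :
  linear f -> linear g -> linear h ->
  (forall x, (∑(a, b ← Δ x) f a * g b) = ε x *: (1 : (A ⊗ A)%type)) ->
  (forall x, (∑(a, b ← Δ x) g a * h b) = ε x *: (1 : (A ⊗ A)%type)) ->
  f =1 h.
Proof.
move=> lf lg lh fg gh x.
transitivity (∑(a, c ← Δ x) ∑(a, b ← Δ a) (f a * g b * h c)); last first.
  rewrite -[RHS](counitl (f := h)) //; apply: eq_lift => a c.
  rewrite -(lift_comp (g := fun z : (A ⊗ A)%type => z * h c)); last by lin.
  by rewrite fg -tensor_scaleAl mul1r.
rewrite (coassoc (f := fun a b c => f a * g b * h c)); try by move=> *; lin.
rewrite -[LHS](counitr (f := f)) //; apply: eq_lift => a c.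
transitivity (∑(b, c ← Δ c) f a * (g b * h c)); last first.
  by apply: eq_lift => *; rewrite mulrA.
rewrite -(lift_comp (g := fun z : (A ⊗ A)%type => f a * z)); last by lin.
by rewrite gh -tensor_scaleAr mulr1.
Qed.

(** Both Δ ∘ S and x ↦ S(x_2) ⊗ S(x_1) are convolution inverses of Δ. *)
Lemma comul_antipode x : Δ (S x) = ∑(a, b ← Δ x) S b ⊗ S a.
Proof.
move: x; apply: (@convolution_inverse_unique _ Δ).
- by lin.
- by lin.
- by lin.
- move=> x; transitivity (∑(a, b ← Δ x) Δ (S a * b)).
    by apply: eq_lift => a b; rewrite rmorphM.
  by rewrite antipodel ?rmorph1 //; lin.
move=> x.
transitivity (∑(a, b ← Δ x) ∑(c, d ← Δ b) ∑(p, q ← Δ a) (p * S d) ⊗ (q * S c)).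
  apply: eq_lift => a b.
  rewrite (lift_comp (g := fun z : (A ⊗ A)%type => Δ a * z)); last by lin.
  apply: eq_lift => c d; rewrite -[Δ a in LHS]lift_id.
  rewrite (lift_comp (g := fun z : (A ⊗ A)%type => z * _)); last by lin.
  by apply: eq_lift => p q; rewrite tensM.
rewrite -(coassoc (f := fun a c d => ∑(p, q ← Δ a) (p * S d) ⊗ (q * S c)));
  try by move=> *; lin.
transitivity (∑(a, d ← Δ x) (a * S d) ⊗ (1 : A)); last first.
  by rewrite (antipoder (f := fun z => z ⊗ 1)) //; lin.
apply: eq_lift => a d.
rewrite (coassoc (f := fun p q c => (p * S d) ⊗ (q * S c))); try by move=> *; lin.
rewrite -[RHS](counitr (f := fun p => (p * S d) ⊗ 1)); last by lin.
apply: eq_lift => p q.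
by rewrite (antipoder (f := fun z => (p * S d) ⊗ z)) //; lin.
Qed.

Lemma counit_antipode x : ε (S x) = ε x.
Proof.
transitivity (ε (∑(a, b ← Δ x) S a * b)); last first.
  by rewrite comul_antipodel linearZ /= rmorph1 mulr1.
rewrite -[in LHS](comul_counitr x) /tensor_lift !linear_sum /=.
by apply: eq_bigr => p _; rewrite !linearZ /= rmorphM mulrC.
Qed.

End Antipode.

(** * Subspaces and slices of tensors *)

Section Subspaces.
Context {K : fieldType}.

Definition subspace {V : lmodType K} (W : set V) :=
  W 0 /\ forall k u v, W u -> W v -> W (k *: u + v).

Lemma subspaceP (V : lmodType K) (W : set V) :
  GRing.submod_closed (mem W) <-> subspace W.
Proof.
split=> -[W0 WP]; split; try by move: W0; rewrite in_setE.
  by move=> k u v Wu Wv; have := WP k u v; rewrite !in_setE; apply.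
by move=> k u v; rewrite !in_setE; apply: WP.
Qed.

Lemma subspaceZ (V : lmodType K) (W : set V) k v :
  subspace W -> W v -> W (k *: v).
Proof. by move=> [W0 WP] Wv; rewrite -[_ *: _]addr0; apply: WP. Qed.

Lemma subspaceB (V : lmodType K) (W : set V) u v :
  subspace W -> W u -> W v -> W (u - v).
Proof. by move=> [W0 WP] Wu Wv; rewrite -scaleN1r addrC; apply: WP. Qed.

Lemma subspaceD (V : lmodType K) (W : set V) u v :
  subspace W -> W u -> W v -> W (u + v).
Proof. by move=> [W0 WP] Wu Wv; rewrite -[u]scale1r; apply: WP. Qed.

Lemma subspace_sum (V : lmodType K) (W : set V) I (r : seq I) (F : I -> V) :
  subspace W -> (forall i, W (F i)) -> W (\sum_(i <- r) F i).
Proof.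
move=> sW WF; apply: big_ind => //; first by case: sW.
by move=> u v; apply: subspaceD.
Qed.

(** A maximal subspace meeting W trivially is a complement of W. *)
Lemma subspace_projection (V : lmodType K) (W : set V) : subspace W ->
  exists p : V -> V, [/\ linear p, forall v, W (p v) & forall w, W w -> p w = w].
Proof.
move=> sW.
(* Closure under k u + v does not ask for 0 ∈ C, so that the union of the
   empty chain qualifies. *)
pose indep (C : set V) := (forall k u v, C u -> C v -> C (k *: u + v)) /\
  (forall v, C v -> W v -> v = 0).
have [F Findep Ftot|C [[Clin CW] Cmax]] := @Zorn_bigcup V indep.
  split=> [k u v [X FX Xu] [Y FY Yv]|v [X FX Xv]]; last by apply: (Findep X FX).2.
  case: (Ftot X Y FX FY) => [XY|YX].
    by exists Y => //; apply: (Findep Y FY).1 => //; apply: XY.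
  by exists X => //; apply: (Findep X FX).1 => //; apply: YX.
have C0 : C 0.
  apply: contrapT => nC0; have [] := Cmax [set 0].
    split=> [c Cc|/(_ 0 erefl) //].
    by exfalso; apply: nC0; rewrite -(addNr c) -scaleN1r; apply: Clin.
  by split=> [k u v /= -> ->|//]; rewrite scaler0 addr0.
have sC : subspace C by [].
(* Otherwise adjoining v to C would contradict maximality. *)
have decomp v : exists w, W w /\ C (v - w).
  apply: contrapT => nv; have [] := Cmax [set x | exists k c,
    C c /\ x = k *: v + c].
    split=> [c Cc|vC]; first by exists 0, c; rewrite scale0r add0r.
    apply: nv; exists 0; split; first by case: sW.
    by rewrite subr0; apply: vC; exists 1, 0; rewrite scale1r addr0.
  split=> [k _ _ [k1 [c1 [Cc1 ->]]] [k2 [c2 [Cc2 ->]]]|x [k [c [Cc ->]]] Wx].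
    exists (k * k1 + k2), (k *: c1 + c2); split; first exact: Clin.
    by rewrite scalerDl scalerDr scalerA addrACA.
  have [k0|k0] := eqVneq k 0.
    by move: Wx; rewrite k0 scale0r add0r; apply: CW.
  exfalso; apply: nv; exists (k^-1 *: (k *: v + c)).
  split; first exact: subspaceZ.
  rewrite scalerDr scalerA mulVf // scale1r opprD addNKr.
  by rewrite -scaleNr; apply: subspaceZ.
have [p pP] := choice decomp.
have uniq v w : W w -> C (v - w) -> p v = w.
  have [Wp Cp] := pP v; move=> Ww Cw; apply/eqP; rewrite -subr_eq0; apply/eqP.
  apply: CW; last exact: subspaceB.
  by have := subspaceB sC Cw Cp; rewrite opprB addrC addrA subrK.
exists p; split=> [k u v|v|w Ww]; last 2 first.
- by case: (pP v).
- by apply: uniq => //; rewrite subrr.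
have [Wu Cu] := pP u; have [Wv Cv] := pP v.
apply: uniq; first by case: sW => _; apply.
by rewrite opprD addrACA -scalerBr; apply: Clin.
Qed.

Lemma separating_functional (V : lmodType K) (w : V) : w != 0 ->
  exists2 psi : V -> K, scalar psi & psi w = 1.
Proof.
move=> w0; pose W : set V := [set v | exists k, v = k *: w].
have [|p [lp Wp pW]] := @subspace_projection V W.
  split=> [|k _ _ [k1 ->] [k2 ->]]; first by exists 0; rewrite scale0r.
  by exists (k * k1 + k2); rewrite scalerDl scalerA.
have [psi pE] := choice Wp.
have inj k l : k *: w = l *: w -> k = l.
  move/eqP; rewrite -subr_eq0 -scalerBl scaler_eq0 (negPf w0) orbF subr_eq0.
  by move/eqP.
exists psi => [k u v|]; apply: inj.
  by rewrite -pE lp !pE scalerDl scalerA.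
by rewrite -pE scale1r; apply: pW; exists 1; rewrite scale1r.
Qed.

(** A finite rank operator fixing finitely many vectors is built one vector u
    at a time: when E fixes the previous ones, E + (u - E u) psi(id - E) fixes
    u as well, for a functional psi with psi(u - E u) = 1. *)
Lemma finite_rank_identity (U : lmodType K) (M : set U) (us : seq U) :
  subspace M -> (forall u, u \in us -> M u) ->
  exists n (a : nat -> U) (phi : nat -> U -> K),
    [/\ forall i, M (a i), forall i, scalar (phi i)
      & forall u, u \in us -> u = \sum_(i < n) phi i u *: a i].
Proof.
move=> sM; elim: us => [|u us IHus] Mus.
  exists 0%N, (fun=> 0), (fun _ _ => 0); split=> //; first by case: sM.
  by move=> _ k x y; rewrite mulr0 addr0.
have [|n [a [phi [Ma lphi Eus]]]] := IHus.
  by move=> v vus; apply: Mus; rewrite inE vus orbT.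
pose E v := \sum_(i < n) phi i v *: a i.
have lE : linear E.
  move=> k x y; rewrite /E scaler_sumr -big_split; apply: eq_bigr => i _.
  by rewrite lphi scalerDl scalerA.
have [Eu|Eu] := eqVneq (u - E u) 0.
  exists n, a, phi; split=> // v; rewrite inE => /predU1P[->|/Eus//].
  by move/eqP: Eu; rewrite subr_eq0 => /eqP.
have [psi lpsi psi1] := separating_functional Eu.
exists n.+1, (fun i => if (i < n)%N then a i else u - E u),
  (fun i => if (i < n)%N then phi i else fun v => psi (v - E v)); split.
- move=> i; case: ifP => // _; apply: subspaceB => //.
    by apply: Mus; rewrite mem_head.
  by apply: subspace_sum => // j; apply: subspaceZ.
- move=> i; case: ifP => // _ k x y.
  by rewrite lE opprD addrACA -scalerBr lpsi.
have EE v : \sum_(i < n.+1)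
    (if (i < n)%N then phi i else fun v => psi (v - E v)) v
    *: (if (i < n)%N then a i else u - E u) = E v + psi (v - E v) *: (u - E u).
  rewrite big_ord_recr /= ltnn; congr (_ + _).
  by apply: eq_bigr => i _; rewrite ltn_ord.
move=> v; rewrite inE EE => /predU1P[->|/Eus vE].
  by rewrite psi1 scale1r addrC subrK.
have Ev : E v = v by [].
have := lpsi (-1) 0 0; rewrite scaleN1r oppr0 addr0 mulN1r addNr => psi0.
by rewrite Ev subrr psi0 scale0r addr0.
Qed.

(** The slices (phi ⊗ id)(t) and (id ⊗ psi)(t). *)
Definition lslice {U V : lmodType K} (phi : U -> K) (t : (U ⊗ V)%type) : V :=
  ∑(u, v ← t) phi u *: v.

Definition rslice {U V : lmodType K} (psi : V -> K) (t : (U ⊗ V)%type) : U :=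
  ∑(u, v ← t) psi v *: u.

Lemma lslice_sum (U V : lmodType K) (phi : U -> K) I (r : seq I)
    (F : I -> U) (G : I -> V) : scalar phi ->
  lslice phi (\sum_(i <- r) F i ⊗ G i) = \sum_(i <- r) phi (F i) *: G i.
Proof.
move=> lphi; have bl : bilin (fun (u : U) (v : V) => phi u *: v) by lin.
rewrite /lslice (lin_sum (tensor_lift_linear bl)).
by apply: eq_bigr => i _; rewrite liftE.
Qed.

(** A finite rank operator on U fixing the first factors of t rewrites t in
    terms of its slices.  So t lies in U ⊗ N as soon as its left slices lie
    in N, and this does not spoil first factors already chosen in M. *)
Lemma lslice_decomposition (U V : lmodType K) (M : set U) (s : seq (U * V)) :
  subspace M -> (forall p, p \in s -> M p.1) ->
  let t := \sum_(p <- s) p.1 ⊗ p.2 in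
  exists n (a : nat -> U) (phi : nat -> U -> K),
    [/\ forall i, M (a i), forall i, scalar (phi i)
      & t = \sum_(i < n) a i ⊗ lslice (phi i) t].
Proof.
move=> sM Ms t.
have [|n [a [phi [Ma lphi E]]]] := @finite_rank_identity _ M (map fst s) sM.
  by move=> _ /mapP[p ps ->]; apply: Ms.
exists n, a, phi; split=> //.
under eq_bigr => i _ do rewrite lslice_sum // linear_sumr.
rewrite exchange_big; apply: eq_big_seq => p ps /=.
rewrite [in LHS](E p.1) ?map_f //.
rewrite (lin_sum (f := fun u => u ⊗ p.2)); last by lin.
by apply: eq_bigr => i _; rewrite linearZl_LR linearZr_LR.
Qed.

Lemma lslice_expansion (U V : lmodType K) (t : (U ⊗ V)%type) :
  exists n (a : nat -> U) (phi : nat -> U -> K),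
    (forall i, scalar (phi i)) /\ t = \sum_(i < n) a i ⊗ lslice (phi i) t.
Proof.
have [||n [a [phi [_ lphi E]]]] := @lslice_decomposition U V setT (repr t) => //.
by exists n, a, phi; split=> //; rewrite [t]tensorE.
Qed.

Lemma rslice_expansion (U V : lmodType K) (t : (U ⊗ V)%type) :
  exists n (b : nat -> V) (psi : nat -> V -> K),
    (forall i, scalar (psi i)) /\ t = \sum_(i < n) rslice (psi i) t ⊗ b i.
Proof.
have bl (X Y : lmodType K) : bilin (fun (u : X) (v : Y) => v ⊗ u) by lin.
have [n [b [psi [lpsi E]]]] := lslice_expansion (∑(u, v ← t) v ⊗ u).
exists n, b, psi; split=> //.
rewrite -[LHS]lift_id.
have -> : (∑(a, b ← t) a ⊗ b) = ∑(v, u ← ∑(u, v ← t) v ⊗ u) u ⊗ v.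
  by rewrite lift_lift //; apply: eq_lift => a c; rewrite liftE.
rewrite E (lin_sum (tensor_lift_linear (bl _ _))).
apply: eq_bigr => i _; rewrite liftE //; congr (_ ⊗ _).
rewrite /lslice lift_lift; last by lin.
by apply: eq_lift => u v; rewrite liftE //; lin.
Qed.

End Subspaces.

(** * Stabilizers *)

Section Stabilizers.
Context {K : fieldType} {A : hopfAlgType K}.
Implicit Types (x y P : A).
Local Notation S := (@antipode K A).
Local Notation ε := (@counit K A).

(** The analogue of [stabilizer] for left group-like projections. *)
Definition costabilizer P : set A :=
  [set x | Δ x * (P ⊗ 1) = P ⊗ x /\ (P ⊗ 1) * Δ x = P ⊗ x].

Lemma subspace_stabilizer P : subspace (stabilizer P).
Proof.
have l1 : linear (fun x => Δ x * (1 ⊗ P)) by lin.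
have l2 : linear (fun x => (1 ⊗ P) * Δ x) by lin.
have l3 : linear (fun x => x ⊗ P) by lin.
split=> [|k u v [u1 u2] [v1 v2]].
  by split; rewrite ?(lin0 l1) ?(lin0 l2) (lin0 l3).
by split; rewrite ?l1 ?l2 l3 ?u1 ?u2 ?v1 ?v2.
Qed.

Lemma subspace_costabilizer P : subspace (costabilizer P).
Proof.
have l1 : linear (fun x => Δ x * (P ⊗ 1)) by lin.
have l2 : linear (fun x => (P ⊗ 1) * Δ x) by lin.
have l3 : linear (fun x => P ⊗ x) by lin.
split=> [|k u v [u1 u2] [v1 v2]].
  by split; rewrite ?(lin0 l1) ?(lin0 l2) (lin0 l3).
by split; rewrite ?l1 ?l2 l3 ?u1 ?u2 ?v1 ?v2.
Qed.

Lemma stabilizer1 P : stabilizer P 1.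
Proof. by split; rewrite rmorph1 ?mul1r ?mulr1. Qed.

Lemma stabilizerM P x y :
  stabilizer P x -> stabilizer P y -> stabilizer P (x * y).
Proof.
have E z : z ⊗ P = (1 ⊗ P) * (z ⊗ 1) :> (A ⊗ A)%type.
  by rewrite tensM mul1r mulr1.
have E' z : z ⊗ P = (z ⊗ 1) * (1 ⊗ P) :> (A ⊗ A)%type.
  by rewrite tensM mul1r mulr1.
move=> [x1 x2] [y1 y2]; split; rewrite rmorphM /=.
  by rewrite -mulrA y1 E mulrA x1 tensM mulr1.
by rewrite mulrA x2 E' -mulrA y2 tensM mul1r.
Qed.

(** By coassociativity, slicing Δ(x) and then applying one of the defining
    equations amounts to applying the equation for x and slicing the result. *)
Lemma lslice_stabilizer P x (phi : A -> K) : scalar phi ->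
  stabilizer P x -> stabilizer P (lslice phi (Δ x)).
Proof.
move=> lphi [x1 x2].
have bF : bilin (fun a b : A => ∑(c, d ← Δ a) phi c *: (d ⊗ b)) by lin.
have E : (∑(a, b ← x ⊗ P) ∑(c, d ← Δ a) phi c *: (d ⊗ b))
    = lslice phi (Δ x) ⊗ P.
  rewrite liftE // (lift_comp (g := fun z => z ⊗ P)); last by lin.
  by apply: eq_lift => c d; rewrite linearZl_LR.
have D : Δ (lslice phi (Δ x)) = ∑(a, b ← Δ x) phi a *: Δ b.
  by rewrite (lift_comp (g := Δ)); [apply: eq_lift => *; rewrite linearZ | lin].
split; rewrite -E D.
- rewrite -x1 lift_mulr //.
  under [RHS]eq_lift => a b do rewrite mulr1.
  rewrite (coassoc (f := fun c d b => phi c *: (d ⊗ (b * P))));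
    try by move=> *; lin.
  rewrite (lift_comp (g := fun z : (A ⊗ A)%type => z * _)); last by lin.
  apply: eq_lift => a b; rewrite -[Δ b in LHS]lift_id -tensor_scaleAl.
  rewrite (lift_comp (g := fun z : (A ⊗ A)%type => phi a *: (z * _)));
    last by lin.
  by apply: eq_lift => c d; rewrite tensM mulr1.
- rewrite -x2 lift_mull //.
  under [RHS]eq_lift => a b do rewrite mul1r.
  rewrite (coassoc (f := fun c d b => phi c *: (d ⊗ (P * b))));
    try by move=> *; lin.
  rewrite (lift_comp (g := fun z : (A ⊗ A)%type => _ * z)); last by lin.
  apply: eq_lift => a b; rewrite -[Δ b in LHS]lift_id -tensor_scaleAr.
  rewrite (lift_comp (g := fun z : (A ⊗ A)%type => phi a *: (_ * z)));
    last by lin.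
  by apply: eq_lift => c d; rewrite tensM mul1r.
Qed.

Lemma rslice_costabilizer P x (psi : A -> K) : scalar psi ->
  costabilizer P x -> costabilizer P (rslice psi (Δ x)).
Proof.
move=> lpsi [x1 x2].
have bF : bilin (fun a b : A => ∑(c, d ← Δ b) psi d *: (a ⊗ c)) by lin.
have E : (∑(a, b ← P ⊗ x) ∑(c, d ← Δ b) psi d *: (a ⊗ c))
    = P ⊗ rslice psi (Δ x).
  rewrite liftE // (lift_comp (g := fun z => P ⊗ z)); last by lin.
  by apply: eq_lift => c d; rewrite linearZr_LR.
have D : Δ (rslice psi (Δ x)) = ∑(a, b ← Δ x) psi b *: Δ a.
  by rewrite (lift_comp (g := Δ)); [apply: eq_lift => *; rewrite linearZ | lin].
split; rewrite -E D.
- rewrite -x1 lift_mulr //.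
  under [RHS]eq_lift => a b do rewrite mulr1.
  rewrite -(coassoc (f := fun a c d => psi d *: ((a * P) ⊗ c)));
    try by move=> *; lin.
  rewrite (lift_comp (g := fun z : (A ⊗ A)%type => z * _)); last by lin.
  apply: eq_lift => a b; rewrite -[Δ a in LHS]lift_id -tensor_scaleAl.
  rewrite (lift_comp (g := fun z : (A ⊗ A)%type => psi b *: (z * _)));
    last by lin.
  by apply: eq_lift => c d; rewrite tensM mulr1.
- rewrite -x2 lift_mull //.
  under [RHS]eq_lift => a b do rewrite mul1r.
  rewrite -(coassoc (f := fun a c d => psi d *: ((P * a) ⊗ c)));
    try by move=> *; lin.
  rewrite (lift_comp (g := fun z : (A ⊗ A)%type => _ * z)); last by lin.
  apply: eq_lift => a b; rewrite -[Δ a in LHS]lift_id -tensor_scaleAr.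
  rewrite (lift_comp (g := fun z : (A ⊗ A)%type => psi b *: (_ * z)));
    last by lin.
  by apply: eq_lift => c d; rewrite tensM mul1r.
Qed.

(** The antipode and its inverse both qualify as R. *)
Section AntiMorphism.
Variables (R : A -> A) (P : A).
Hypotheses (Rlin : linear R) (RM : forall x y, R (x * y) = R y * R x).
Hypothesis RΔ : forall x, Δ (R x) = ∑(a, b ← Δ x) R b ⊗ R a.
Hypothesis RP : R P = P.

Lemma anti_stabilizer x : stabilizer P x -> costabilizer P (R x).
Proof.
move=> [x1 x2]; have bR : bilin (fun a b => R b ⊗ R a) by lin.
split; rewrite RΔ -[in RHS]RP -[RHS](liftE _ _ bR).
- rewrite -x2 lift_mull //.
  rewrite (lift_comp (g := fun z : (A ⊗ A)%type => z * _)); last by lin.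
  by apply: eq_lift => a b; rewrite tensM mulr1 mul1r RM RP.
- rewrite -x1 lift_mulr //.
  rewrite (lift_comp (g := fun z : (A ⊗ A)%type => _ * z)); last by lin.
  by apply: eq_lift => a b; rewrite tensM mulr1 mul1r RM RP.
Qed.

Lemma anti_costabilizer x : costabilizer P x -> stabilizer P (R x).
Proof.
move=> [x1 x2]; have bR : bilin (fun a b => R b ⊗ R a) by lin.
split; rewrite RΔ -[in RHS]RP -[RHS](liftE _ _ bR).
- rewrite -x2 lift_mull //.
  rewrite (lift_comp (g := fun z : (A ⊗ A)%type => z * _)); last by lin.
  by apply: eq_lift => a b; rewrite tensM mulr1 mul1r RM RP.
- rewrite -x1 lift_mulr //.
  rewrite (lift_comp (g := fun z : (A ⊗ A)%type => _ * z)); last by lin.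
  by apply: eq_lift => a b; rewrite tensM mulr1 mul1r RM RP.
Qed.

End AntiMorphism.

(** S(x_1) x_2 ⊗ x_3 = 1 ⊗ x. *)
Lemma antipode_comul_cancel x : (∑(a, b ← Δ x) ((S a ⊗ 1) * Δ b)) = 1 ⊗ x.
Proof.
transitivity (∑(a, b ← Δ x) ∑(b, c ← Δ b) (S a * b) ⊗ c).
  apply: eq_lift => a b; rewrite -[Δ b in LHS]lift_id.
  rewrite (lift_comp (g := fun z : (A ⊗ A)%type => _ * z)); last by lin.
  by apply: eq_lift => c d; rewrite tensM mul1r.
rewrite -(coassoc (f := fun a b c => (S a * b) ⊗ c)); try by move=> *; lin.
rewrite -[RHS](counitl (f := fun z => 1 ⊗ z)); last by lin.
apply: eq_lift => a c.
by rewrite (antipodel (f := fun z => z ⊗ c)) //; lin.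
Qed.

(** By [antipode_comul_cancel] the left-hand side is
    (S(x_1) ⊗ 1) Δ(x_2 P), and x_1 ⊗ x_2 P = x ⊗ P. *)
Lemma stabilizer_twist P x : stabilizer P x ->
  (1 ⊗ x) * Δ P = (S x ⊗ 1) * Δ P.
Proof.
move=> [x1 _].
have bG : bilin (fun a b => (S a ⊗ (1 : A)) * Δ b) by lin.
rewrite -[RHS](liftE _ _ bG) -x1 lift_mulr // -antipode_comul_cancel.
rewrite (lift_comp (g := fun z : (A ⊗ A)%type => z * _)); last by lin.
by apply: eq_lift => a b; rewrite mulr1 rmorphM mulrA.
Qed.

End Stabilizers.

(** * Group-like projections and integrals *)

Section GroupLike.
Context {K : fieldType} {A : hopfAlgType K}.
Implicit Types (x y P : A) (N I : set A).
Local Notation S := (@antipode K A).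
Local Notation ε := (@counit K A).

Lemma antipode1 : S 1 = 1.
Proof.
have := comul_antipodel (1 : A).
by rewrite !rmorph1 scale1r -tens1 liftE ?mulr1 //; lin.
Qed.

Lemma stabilizer_counit P x : stabilizer P x ->
  x * P = ε x *: P /\ P * x = ε x *: P.
Proof.
move=> [x1 x2]; have bG : bilin (fun a b : A => ε a *: b) by lin.
rewrite -(liftE x P bG); split.
  rewrite -x1 lift_mulr // -[in LHS](counitl (f := fun z => z * P)); last by lin.
  by apply: eq_lift => a b; rewrite mulr1.
rewrite -x2 lift_mull // -[in LHS](counitl (f := fun z => P * z)); last by lin.
by apply: eq_lift => a b; rewrite mul1r.
Qed.

Lemma right_group_likeE P :
  right_group_like_projection P <-> nonzero_projection P /\ stabilizer P P.
Proof. by split=> [[? ? ?]|[? []]]; split. Qed.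

Lemma left_group_likeE P :
  left_group_like_projection P <-> nonzero_projection P /\ costabilizer P P.
Proof. by split=> [[? ? ?]|[? []]]; split. Qed.

Lemma group_like_counit P : nonzero_projection P -> stabilizer P P -> ε P = 1.
Proof.
move=> [P0 PP] /stabilizer_counit[]; rewrite PP => /eqP.
rewrite -subr_eq0 -[X in X - _]scale1r -scalerBl scaler_eq0 (negPf P0) orbF.
by rewrite subr_eq0 => /eqP.
Qed.

(** The twist identity at x = P and the left group-like condition give
    (S(P) ⊗ 1) Δ(P) = (P ⊗ 1) Δ(P); the map a ⊗ b ↦ a S(b) sends
    (c ⊗ 1) Δ(P) to c ε(P) = c. *)
Lemma two_sided_antipode P : nonzero_projection P ->
  stabilizer P P -> costabilizer P P -> S P = P.
Proof.
move=> nP NP [_ MP]; have := stabilizer_twist NP; rewrite NP.2 -MP.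
have bG : bilin (fun a b => a * S b) by lin.
have G c : (∑(a, b ← (c ⊗ 1) * Δ P) a * S b) = c.
  rewrite lift_mull // -[RHS]mulr1.
  transitivity (∑(a, b ← Δ P) c * (a * S b)).
    by apply: eq_lift => a b; rewrite mul1r mulrA.
  rewrite (antipoder (f := fun z => c * z)); last by lin.
  by rewrite (group_like_counit nP) // scale1r.
by move/(congr1 (tensor_lift (fun a b => a * S b))); rewrite !G.
Qed.

(** Applying id ⊗ ε to the twist identity at x = P gives S(P) P = P, which S
    maps to S(P) S^2(P) = S(P). *)
Lemma antipode_sqr_group_like P : nonzero_projection P -> stabilizer P P ->
  S (S P) = P -> S P = P.
Proof.
move=> nP NP SSP.
have bG : bilin (fun a b : A => ε b *: a) by lin.
have SPP : S P * P = P.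
  have := congr1 (tensor_lift (fun a b => ε b *: a)) (stabilizer_twist NP).
  rewrite NP.2 liftE // (group_like_counit nP) // scale1r lift_mull // => H.
  rewrite [RHS]H.
  rewrite -[in LHS](counitr (f := fun z => S P * z)); last by lin.
  by apply: eq_lift => a b; rewrite mul1r.
by have := congr1 S SPP; rewrite antipodeM SSP SPP.
Qed.

Lemma left_coideal_subalgebra_stabilizer P :
  left_coideal_subalgebra (stabilizer P).
Proof.
have [N0 NP] := subspace_stabilizer P.
split.
  split; first by rewrite in_setE; apply: stabilizer1.
    by move=> k u v; rewrite !in_setE; apply: NP.
  by move=> u v; rewrite !in_setE; apply: stabilizerM.
move=> _ [x Nx <-]; have [n [a [phi [lphi E]]]] := lslice_expansion (Δ x).
exists [seq (a i, lslice (phi i) (Δ x)) | i : 'I_n <- enum 'I_n].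
  by move=> _ /mapP[i _ ->]; apply: lslice_stabilizer.
by rewrite {1}E big_map big_enum.
Qed.

(** Left slices of Δ(P) stabilize P and right slices costabilize it, so Δ(P)
    lies in M_P ⊗ N_P. *)
Lemma comul_decomposition P : stabilizer P P -> costabilizer P P ->
  exists n (a : nat -> A) (phi : nat -> A -> K),
    [/\ forall i, costabilizer P (a i), forall i, scalar (phi i)
      & Δ P = \sum_(i < n) a i ⊗ lslice (phi i) (Δ P)].
Proof.
move=> NP MP; have [m [b [psi [lpsi E]]]] := rslice_expansion (Δ P).
pose s := [seq (rslice (psi i) (Δ P), b i) | i : 'I_m <- enum 'I_m].
have sE : Δ P = \sum_(p <- s) p.1 ⊗ p.2.
  by rewrite {1}E big_map big_enum.
rewrite sE; apply: lslice_decomposition; first exact: subspace_costabilizer.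
by move=> _ /mapP[i _ ->]; apply: rslice_costabilizer.
Qed.

(** For y ∈ N_P, the element y (phi ⊗ id)(Δ P) is a slice of (1 ⊗ y) Δ(P),
    that is of (S(y) ⊗ 1) Δ(P) ∈ A ⊗ N, and therefore lies in N.  As
    1 = ∑ S(a_i) b_i for the decomposition of Δ(P) in M_P ⊗ N_P, any x ∈ N_P
    is the sum of the elements (x S(a_i)) b_i ∈ N. *)
Lemma stabilizer_sub N P : left_coideal_subalgebra N ->
  N P -> nonzero_projection P -> stabilizer P P -> costabilizer P P ->
  stabilizer P `<=` N.
Proof.
move=> [[_ Nlin NM] Ncoid] NP nP sP cP x Nx.
have sN : subspace N.
  apply/subspaceP; split=> //; rewrite in_setE -[0](addNr P) -scaleN1r.
  by rewrite -in_setE; apply: Nlin; rewrite in_setE.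
have [n [a [phi [Ma lphi E]]]] := comul_decomposition sP cP.
have Nlslice y f : stabilizer P y -> scalar f -> N (y * lslice f (Δ P)).
  move=> Ny lf.
  have lslM c z :
      lslice f ((c ⊗ z) * Δ P) = ∑(u, v ← Δ P) f (c * u) *: (z * v).
    by rewrite /lslice lift_mull //; lin.
  have -> : y * lslice f (Δ P) = lslice f ((1 ⊗ y) * Δ P).
    rewrite lslM (lift_comp (g := fun z => y * z)); last by lin.
    by apply: eq_lift => u v; rewrite mul1r scalerAr.
  rewrite (stabilizer_twist Ny).
  have [s Ns ->] : tensor_setr N (Δ P) by apply: Ncoid; exists P.
  rewrite mulr_sumr (eq_bigr (fun p => (S y * p.1) ⊗ p.2)); last first.
    by move=> p _; rewrite tensM mul1r.
  rewrite lslice_sum // big_seq; apply: big_ind.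
  - by case: sN.
  - by move=> u v; apply: subspaceD.
  - by move=> p ps; apply: subspaceZ (Ns p ps).
have e1 : (1 : A) = \sum_(i < n) S (a i) * lslice (phi i) (Δ P).
  have := comul_antipodel P; rewrite (group_like_counit nP sP) scale1r => <-.
  rewrite {1}E; have bG : bilin (fun a b => S a * b) by lin.
  rewrite (lin_sum (tensor_lift_linear bG)).
  by apply: eq_bigr => i _; rewrite liftE.
rewrite -[x]mulr1 e1 mulr_sumr; apply: subspace_sum => // i.
rewrite mulrA; apply: Nlslice => //; apply: stabilizerM => //.
have lS : linear S by exact: linearP.
have SP := two_sided_antipode nP sP cP.
exact: (anti_costabilizer lS antipodeM comul_antipode SP (Ma i)).
Qed.

(** Write Δ(x) = ∑ a_i ⊗ b_i with b_i ∈ N; then b_i P = ε(b_i) P, and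
    ∑ ε(b_i) a_i = x. *)
Lemma integral_stabilizer N P : left_coideal_subalgebra N ->
  (forall x, N x -> x * P = ε x *: P /\ P * x = ε x *: P) ->
  N `<=` stabilizer P.
Proof.
move=> [_ Ncoid] NP x Nx.
have [s Ns E] : tensor_setr N (Δ x) by apply: Ncoid; exists x.
have xE : x = \sum_(p <- s) ε p.2 *: p.1.
  have bG : bilin (fun a b : A => ε b *: a) by lin.
  rewrite -{1}(comul_counitr x) E (lin_sum (tensor_lift_linear bG)).
  by apply: eq_bigr => p _; rewrite liftE.
rewrite /stabilizer /= {2 4}xE E (lin_sum (f := fun z => z ⊗ P)); last by lin.
split; rewrite ?mulr_suml ?mulr_sumr; apply: eq_big_seq => p /Ns /NP[p1 p2].
  by rewrite tensM mulr1 p1 linearZr_LR linearZl_LR.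
by rewrite tensM mul1r p2 linearZr_LR linearZl_LR.
Qed.

(** Decompose 1 = e + P along N = N^+ ⊕ J, where N^+ is N ∩ ker ε.  As
    N^+ J = 0, P is a left integral.  The left ideal P N^+ has square zero,
    while in a semisimple algebra a left ideal is generated by an idempotent;
    hence P N^+ = 0, and P is a right integral. *)
Lemma semisimple_integral N : left_coideal_subalgebra N -> semisimple N ->
  exists P, [/\ N P, ε P = 1
    & forall x, N x -> x * P = ε x *: P /\ P * x = ε x *: P].
Proof.
move=> [Nalg _] ssN.
have sN : subspace N by apply/subspaceP/GRing.subalg_closedZ.
have [] := Nalg; rewrite in_setE => N1 _ NMm.
have NM x y : N x -> N y -> N (x * y).
  by have := NMm x y; rewrite !in_setE => h *; apply: h.
have lε : scalar ε by exact: linearP.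
pose Np := [set x | N x /\ ε x = 0].
have sNp : subspace Np.
  split; first by split; [case: sN | rewrite raddf0].
  move=> k u v [Nu u0] [Nv v0]; split; first by case: sN => _; apply.
  by rewrite lε u0 v0 mulr0 addr0.
have [|J [[JN /subspaceP sJ JM] NpJ NE]] := ssN Np.
  split; [by move=> x [] | exact/subspaceP|].
  by move=> x y Nx [Ny y0]; split; [apply: NM | rewrite rmorphM /= y0 mulr0].
have : N 1 by [].
rewrite {1}NE => -[e [Ne e0]] [P JP eP].
have εP : ε P = 1 by rewrite -(rmorph1 ε) -eP raddfD /= e0 add0r.
have NP := JN P JP.
have Nε x : N x -> Np (x - ε x *: 1).
  move=> Nx; split; first by apply: subspaceB => //; apply: subspaceZ.
  by rewrite raddfB /= linearZ /= rmorph1 mulr1 subrr.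
have NpP x : Np x -> x * P = 0.
  move=> [Nx x0]; have : (Np `&` J) (x * P).
    by split; [split; [apply: NM | rewrite rmorphM /= x0 mul0r] | apply: JM].
  by rewrite NpJ.
have NP_l x : N x -> x * P = ε x *: P.
  move=> /Nε /NpP /eqP; rewrite mulrBl -scalerAl mul1r subr_eq0.
  by move/eqP.
(* 1 = P m + j along N = P N^+ ⊕ I' gives P x = (P x)(P m) + (P x) j, where
   the first term vanishes and the second one lies in P N^+ ∩ I'. *)
have PNp x : Np x -> P * x = 0.
  move=> Npx; pose I := [set P * n | n in Np].
  have lI : left_ideal N I.
    split.
    - by move=> _ [n [Nn _] <-]; apply: NM.
    - apply/subspaceP; split; first by exists 0; [case: sNp | rewrite mulr0].
      move=> k _ _ [u Nu <-] [v Nv <-]; exists (k *: u + v).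
        by case: sNp => _; apply.
      by rewrite mulrDr scalerAr.
    - move=> y _ Ny [n Nn <-]; exists (ε y *: n); first exact: subspaceZ.
      rewrite mulrA -scalerAr scalerAl; congr (_ * _).
      by rewrite NP_l.
  have [I' [[IN /subspaceP sI' IM'] II NE']] := ssN I lI.
  have : N 1 by [].
  rewrite {1}NE' => -[_ [m Nm <-]] [j Ij mj].
  have Px : P * x = P * x * (P * m) + P * x * j by rewrite -mulrDr mj mulr1.
  have PxPm : P * x * (P * m) = 0 by rewrite -mulrA (mulrA x) NpP // mul0r mulr0.
  rewrite PxPm add0r in Px.
  have : (I `&` I') (P * x).
    split; first by exists x.
    by rewrite Px; apply: IM' => //; apply: NM => //; case: Npx.
  by rewrite II.
exists P; split=> // x Nx.
split; first exact: NP_l.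
have /PNp/eqP := Nε x Nx; rewrite mulrBr -scalerAr mulr1 subr_eq0.
by move/eqP.
Qed.

End GroupLike.

(** * The case of an invertible antipode *)

Section InverseAntipode.
Context {K : fieldType} {A : hopfAlgType K}.
Implicit Types (x y P : A) (N I : set A).
Local Notation S := (@antipode K A).
Local Notation ε := (@counit K A).
Variable T : A -> A.
Hypotheses (ST : cancel S T) (TS : cancel T S).

Lemma antipode_inv_linear : linear T.
Proof. by move=> k x y; apply: (can_inj ST); rewrite linearP /= !TS. Qed.

Lemma antipode_invM x y : T (x * y) = T y * T x.
Proof. by apply: (can_inj ST); rewrite antipodeM !TS. Qed.

Lemma comul_antipode_inv x : Δ (T x) = ∑(a, b ← Δ x) T b ⊗ T a.
Proof.
have lT := antipode_inv_linear.
have -> : Δ x = ∑(a, b ← Δ (T x)) S b ⊗ S a by rewrite -comul_antipode TS.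
have bT : bilin (fun a b => T b ⊗ T a) by lin.
rewrite (lift_lift _ _ bT) -[LHS]lift_id.
by apply: eq_lift => a b; rewrite liftE // !ST.
Qed.

Lemma stabilizer_antipode_sqr P : S P = P ->
  preserved_by_antipode_sqr (stabilizer P).
Proof.
move=> SP; have TP : T P = P by rewrite -{1}SP ST.
have lS : linear S by exact: linearP.
have lT := antipode_inv_linear.
apply/seteqP; split=> [_ [x Nx <-]|x Nx] /=.
  apply: (anti_costabilizer lS antipodeM comul_antipode SP).
  exact: (anti_stabilizer lS antipodeM comul_antipode SP).
exists (T (T x)); last by rewrite /= !TS.
apply: (anti_costabilizer lT antipode_invM comul_antipode_inv TP).
exact: (anti_stabilizer lT antipode_invM comul_antipode_inv TP).
Qed.

(** Maschke's argument with the separability idempotent ∑ b_i ⊗ S^-1(a_i),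
    where Δ(P) = ∑ a_i ⊗ b_i: from a linear projection p onto I one gets the
    N_P-linear projection x ↦ ∑ b_i p(S^-1(a_i) x). *)
Lemma semisimple_stabilizer P : nonzero_projection P ->
  stabilizer P P -> costabilizer P P -> semisimple (stabilizer P).
Proof.
move=> nP sP cP; have lT := antipode_inv_linear.
have SP := two_sided_antipode nP sP cP.
have TP : T P = P by rewrite -{1}SP ST.
have [n [a [phi [Ma lphi E]]]] := comul_decomposition sP cP.
pose b i := lslice (phi i) (Δ P).
have Nb i : stabilizer P (b i) by apply: lslice_stabilizer.
have NTa i : stabilizer P (T (a i)).
  exact: (anti_costabilizer lT antipode_invM comul_antipode_inv TP (Ma i)).
have sumE (f : A -> A -> A) : bilin f ->
    tensor_lift f (Δ P) = \sum_(i < n) f (a i) (b i).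
  move=> bf; rewrite {1}E (lin_sum (tensor_lift_linear bf)).
  by apply: eq_bigr => i _; rewrite liftE.
have bT1 : bilin (fun a b => b * T a) by lin.
have bTa : \sum_(i < n) b i * T (a i) = 1.
  rewrite -(sumE (fun a b => b * T a)) //.
  transitivity (∑(a, b ← Δ P) T (a * S b)).
    by apply: eq_lift => *; rewrite antipode_invM ST.
  rewrite (antipoder _ lT) (group_like_counit nP sP) scale1r.
  by rewrite -[in LHS]antipode1 ST.
have sN := subspace_stabilizer P.
move=> I [IN /subspaceP sI IM].
have [p [lp pI pid]] := subspace_projection sI.
(* The sum over any expression of Δ(P) serves for linearity, the sum over
   the a_i and b_i for q having values in I. *)
pose q x := ∑(a, b ← Δ P) (b * p (T a * x)).
have bq x : bilin (fun a b => b * p (T a * x)) by lin.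
have lq : linear q by rewrite /q; lin.
have qE x : q x = \sum_(i < n) b i * p (T (a i) * x) by rewrite /q sumE.
have qI x : I (q x) by rewrite qE; apply: subspace_sum => // i; apply: IM.
have qid x : I x -> q x = x.
  move=> Ix; rewrite qE -[RHS]mul1r -bTa mulr_suml; apply: eq_bigr => i _.
  by rewrite pid ?mulrA //; apply: IM.
have qM y x : stabilizer P y -> q (y * x) = y * q x.
  move/stabilizer_twist/(congr1 (tensor_lift (fun a b => b * p (T a * x)))).
  rewrite !lift_mull // => H.
  transitivity (∑(a, b ← Δ P) 1 * b * p (T (S y * a) * x)).
    by apply: eq_lift => *; rewrite antipode_invM ST mul1r mulrA.
  rewrite -H (lift_comp (g := fun z => y * z)); last by lin.
  by apply: eq_lift => *; rewrite mul1r mulrA.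
exists [set x | stabilizer P x /\ q x = 0]; split.
- split=> [x []//||y x Ny [Nx qx]].
    apply/subspaceP; split; first by split; [case: sN | rewrite (lin0 lq)].
    move=> k u v [Nu u0] [Nv v0]; split; first by case: sN => _; apply.
    by rewrite lq u0 v0 scaler0 addr0.
  by split; [apply: stabilizerM | rewrite qM // qx mulr0].
- apply/seteqP; split=> [x [Ix [_ qx]]|_ ->] /=.
    by rewrite -(qid _ Ix).
  by split; [case: sI | split; [case: sN | rewrite (lin0 lq)]].
- apply/seteqP; split=> [x Nx|_ [x Ix] [y [Ny _]] <-].
    exists (q x) => //; exists (x - q x); last by rewrite addrC subrK.
    split; first by apply: subspaceB => //; apply: IN.
    by rewrite (linB lq) (qid (q x)) // subrr.
  by apply: subspaceD => //; apply: IN.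
Qed.

End InverseAntipode.

Theorem theorem3p24 (K : fieldType) (A : hopfAlgType K)
    (antipode_bij : bijective (@antipode K A)) :
  set_bij
    [set P : A | two_sided_group_like_projection P]%classic
    [set N : set A | left_coideal_subalgebra N /\ semisimple N /\
                     preserved_by_antipode_sqr N]%classic
    (@stabilizer K A).
Proof.
have [T ST TS] := antipode_bij.
split.
- move=> P [/right_group_likeE[nP sP] /left_group_likeE[_ cP]]; split.
    exact: left_coideal_subalgebra_stabilizer.
  split; first exact: semisimple_stabilizer ST TS _ nP sP cP.
  by apply: stabilizer_antipode_sqr ST TS _ _; apply: two_sided_antipode.
- move=> P Q; rewrite !in_setE.
  move=> [/right_group_likeE[nP sP] _] [/right_group_likeE[nQ sQ] _] PQ.
  have sPQ : stabilizer P Q by rewrite PQ.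
  have sQP : stabilizer Q P by rewrite -PQ.
  have := (stabilizer_counit sPQ).2; have := (stabilizer_counit sQP).1.
  rewrite (group_like_counit nP sP) (group_like_counit nQ sQ) !scale1r.
  by move=> -> ->.
- move=> N [lcN [ssN S2N]].
  have [P [NP εP intP]] := semisimple_integral lcN ssN.
  have nP : nonzero_projection P.
    split; last by rewrite (intP P NP).1 εP scale1r.
    by apply/eqP => P0; move/eqP: εP; rewrite P0 raddf0 eq_sym oner_eq0.
  have NsP := integral_stabilizer lcN intP; have sP := NsP P NP.
  (* P S^2(P) equals P and S^2(P), both factors being integrals of N. *)
  have SSP : antipode (antipode P) = P.
    have : ((antipode \o antipode : A -> A) @` N) P by rewrite S2N.
    case=> x Nx /= SSx.
    have NSSP : N (antipode (antipode P)) by rewrite -[N]S2N; exists P.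
    have εx : counit x = 1 by rewrite -εP -SSx !counit_antipode.
    transitivity (P * antipode (antipode P)).
      by rewrite -{2}SSx -!antipodeM (intP x Nx).1 εx scale1r.
    by rewrite (intP _ NSSP).2 !counit_antipode εP scale1r.
  have SP := antipode_sqr_group_like nP sP SSP.
  have cP : costabilizer P P.
    rewrite -{2}SP; have lS : linear (@antipode K A) by exact: linearP.
    exact: (anti_stabilizer lS (@antipodeM K A) (@comul_antipode K A) SP).
  exists P; first by split; [apply/right_group_likeE | apply/left_group_likeE].
  by apply/seteqP; split; [apply: stabilizer_sub | ].
Qed.
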